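(* For every odd integer $q\ge3$ and every odd prime $\ell$ dividing $q$, the 2-bridge torus knot $K_{1/q}$ satisfies the Hirasawa–Murasugi conjecture (in its strong form) for $\ell$. That is, there are representatives $\tilde\Delta(t)$ of the $\ell$-twisted Alexander polynomial of $K_{1/q}$ (defined up to $\pm t^{r\ell}$, $r\in\mathbb Z$) and $\Delta(t)$ of the Alexander polynomial of $K_{1/q}$ (defined up to $\pm t^{r}$, $r\in\mathbb Z$) and an integer Laurent polynomial $f(t)$ such that $$\tilde\Delta(t)=\frac{\Delta(t)}{t-1}f(t)f(-t)\qquad\text{and}\qquad f(t)\equiv\left(\frac{\Delta(t)}{t+1}\right)^{\frac{\ell-1}{2}}\pmod\ell.$$
   Context: $K_{1/q}$ is the $(2,q)$-torus knot; one representative of its Alexander polynomial is $1-t+t^2-\dots+t^{q-1}$. The congruence mod $\ell$ means $(t+1)^{(\ell-1)/2}f(t)\equiv\Delta(t)^{(\ell-1)/2}$ coefficientwise mod $\ell$. The knot group is $G=\langle a,b\mid aw=wb\rangle$ with $w=(ba)^{(q-1)/2}$. The dihedral group is $D_\ell=\langle x,y\mid x^2=1,\ y^\ell=1,\ yx=xy^{-1}\rangle$. Fix $\pi:D_\ell\to GL(\ell,\mathbb C)$ with $\pi(x)=F$, the matrix with ones on the antidiagonal and zeros elsewhere, and $\pi(y)=R$, the matrix with ones in positions $(1,\ell)$ and $(i+1,i)$, $1\le i<\ell$, and zeros elsewhere. Let $\rho:G\to D_\ell$ be any surjective homomorphism and $\phi=\pi\circ\rho$. With $\partial w/\partial a$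 the Fox derivative, let $$\hat A_\phi=I+(t\phi(a)-I)\left.\frac{\partial w}{\partial a}\right|_{a=t\phi(a),\,b=t\phi(b)}$$ (the group ring element $1$ is replaced by the identity matrix). The $\ell$-twisted Alexander polynomial is $\det\hat A_\phi/\det(t\phi(b)-I)$, considered up to factors $\pm t^{r\ell}$; up to such factors it does not depend on $\rho$. *)

(* Defs.v *)
From HB Require Import structures.
From mathcomp Require Import all_boot all_order all_algebra.
From mathcomp Require Import boolp reals complex.

Set Implicit Arguments.
Unset Strict Implicit.
Unset Printing Implicit Defensive.

Import Order.TTheory GRing.Theory Num.Theory.

(* The letter (x, true) is the generator x, and (x, false) is its inverse. *)
Definition word (T : choiceType) : choiceType := seq (T * bool).

Definition word_inv (T : choiceType) (u : word T) : word T :=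
  rev [seq (l.1, ~~ l.2) | l <- u].

Inductive same_element (T : choiceType) (rels : seq (word T * word T)) :
    word T -> word T -> Prop :=
  | same_refl u : same_element rels u u
  | same_sym u v : same_element rels u v -> same_element rels v u
  | same_trans u v w :
      same_element rels u v -> same_element rels v w -> same_element rels u w
  | same_cat u u' v v' : same_element rels u u' -> same_element rels v v' ->
      same_element rels (u ++ v) (u' ++ v')
  | same_cancel x s : same_element rels [:: (x, s); (x, ~~ s)] [::]
  | same_rel u v : (u, v) \in rels -> same_element rels u v.

Section PresentedGroup.
Variables (T : choiceType) (rels : seq (word T * word T)).

(* Equality of words in the group is undecidable in general, so its boolean
   form is classical. *)
Definition same_elementb (u v : word T) : bool := `[< same_element rels u v >].

Lemma same_elementb_refl : reflexive same_elementb.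
Proof. by move=> u; apply/asboolP; exact: same_refl. Qed.

Lemma same_elementb_sym : symmetric same_elementb.
Proof. by move=> u v; apply/asboolP/asboolP => /same_sym. Qed.

Lemma same_elementb_trans : transitive same_elementb.
Proof.
by move=> v u w /asboolP uv /asboolP vw; apply/asboolP; exact: same_trans uv vw.
Qed.

Canonical same_element_equiv :=
  EquivRel same_elementb
    same_elementb_refl same_elementb_sym same_elementb_trans.

(* The group given by generators T and relations u = v for (u, v) in rels. *)
Definition presented := {eq_quot same_element_equiv}%qT.

HB.instance Definition _ := Choice.on presented.
HB.instance Definition _ := EqQuotient.on presented.

Definition pclass (u : word T) : presented := \pi_presented%qT u.

Definition pgen (x : T) : presented := pclass [:: (x, true)].

Lemma pclassP (u v : word T) : pclass u = pclass v <-> same_element rels u v.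
Proof.
split=> [/eqP|uv]; first by rewrite eqmodE => /asboolP.
by apply/eqP; rewrite eqmodE; apply/asboolP.
Qed.

Lemma pclass_ind (P : presented -> Prop) :
  (forall u, P (pclass u)) -> forall g, P g.
Proof. by move=> Pc g; rewrite -[g]reprK; exact: Pc. Qed.

Definition pmul (g h : presented) : presented := pclass (repr g ++ repr h).
Definition pinv (g : presented) : presented := pclass (word_inv (repr g)).

Lemma same_repr (u : word T) : same_element rels (repr (pclass u)) u.
Proof. by apply/pclassP; rewrite /pclass reprK. Qed.

Lemma pmulE (u v : word T) : pmul (pclass u) (pclass v) = pclass (u ++ v).
Proof. by apply/pclassP; apply: same_cat; exact: same_repr. Qed.

Lemma pmulA : associative pmul.
Proof.
elim/pclass_ind=> u; elim/pclass_ind=> v; elim/pclass_ind=> w.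
by rewrite !pmulE catA.
Qed.

Lemma pmul1 : left_id (pclass [::]) pmul.
Proof. by elim/pclass_ind=> u; rewrite pmulE. Qed.

Lemma pmulr1 : right_id (pclass [::]) pmul.
Proof. by elim/pclass_ind=> u; rewrite pmulE cats0. Qed.

Lemma same_invr (u : word T) : same_element rels (u ++ word_inv u) [::].
Proof.
elim: u => [|[x s] u IHu]; first exact: same_refl.
rewrite /word_inv /= rev_cons -cats1 catA -/(word_inv u) -cat_cons.
apply: same_trans (same_cancel rels x s).
rewrite -[[:: _; _]]/([:: (x, s)] ++ [:: (x, ~~ s)]).
apply: same_cat; last exact: same_refl.
rewrite -cat1s -[X in same_element _ _ X]cats0.
by apply: same_cat IHu; exact: same_refl.
Qed.

Lemma word_invK : involutive (@word_inv T).
Proof.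
move=> u; rewrite /word_inv map_rev revK -map_comp.
by rewrite -[RHS]map_id; apply: eq_map => -[x s] /=; rewrite negbK.
Qed.

Lemma pmulrV : right_inverse (pclass [::]) pinv pmul.
Proof.
move=> g; rewrite -{1}[g]reprK -/(pclass _) pmulE.
by apply/pclassP; exact: same_invr.
Qed.

Lemma pmulVr : left_inverse (pclass [::]) pinv pmul.
Proof.
move=> g; rewrite -{2}[g]reprK -/(pclass _) pmulE.
by apply/pclassP; rewrite -{2}[repr g]word_invK; exact: same_invr.
Qed.

HB.instance Definition _ :=
  isGroup.Build presented pmulA pmul1 pmulr1 pmulVr pmulrV.

End PresentedGroup.

(* Fox derivative with respect to x of a word, as a formal sum (a list of
   coefficient-word pairs) in the integral group ring of the free group. *)
Fixpoint fox (T : choiceType) (x : T) (u : word T) : seq (int * word T) :=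
  if u is (y, s) :: v then
    let tail := [seq (c.1, (y, s) :: c.2) | c <- fox x v] in
    if y != x then tail
    else if s then (1%R, [::]) :: tail
    else ((-1)%R, [:: (y, false)]) :: tail
  else [::].

Notation gen_a := false (only parsing).
Notation gen_b := true (only parsing).

(* w = (ba)^((q-1)/2) *)
Definition knot_word (q : nat) : word bool :=
  flatten (nseq q.-1./2 [:: (gen_b, true); (gen_a, true)]).

(* < a, b | a w = w b > *)
Definition knot_rels (q : nat) : seq (word bool * word bool) :=
  [:: ((gen_a, true) :: knot_word q, rcons (knot_word q) (gen_b, true))].

Notation knot_group q := (presented (knot_rels q)).

Notation gen_x := false (only parsing).
Notation gen_y := true (only parsing).

(* < x, y | x^2 = 1, y^l = 1, y x = x y^-1 > *)
Definition dihedral_rels (l : nat) : seq (word bool * word bool) :=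
  [:: (nseq 2 (gen_x, true), [::]);
      (nseq l (gen_y, true), [::]);
      ([:: (gen_y, true); (gen_x, true)], [:: (gen_x, true); (gen_y, false)])].

Notation dihedral_group l := (presented (dihedral_rels l)).

Definition dihedral_x (l : nat) : dihedral_group l :=
  pgen (dihedral_rels l) gen_x.
Definition dihedral_y (l : nat) : dihedral_group l :=
  pgen (dihedral_rels l) gen_y.

Local Open Scope ring_scope.

Definition flip_mx (C : fieldType) (l : nat) : 'M[C]_l :=
  \matrix_(i, j) (i == rev_ord j)%:R.

Definition shift_mx (C : fieldType) (l : nat) : 'M[C]_l :=
  \matrix_(i, j) (i == ordS j)%:R.

(* As G is a group, the values are automatically invertible: this is a
   homomorphism G -> GL(n, C). *)
Definition is_matrix_rep (C : fieldType) (G : groupType) (n : nat)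
    (rho : G -> 'M[C]_n) : Prop :=
  rho 1%g = 1%:M /\ forall g h : G, rho (g * h)%g = rho g *m rho h.

Section TwistedAlexander.
Variables (C : fieldType) (n : nat).
Local Notation K := {fraction {poly C}}.

Definition ratvar : K := tofrac 'X.

Definition const_frac_mx (M : 'M[C]_n) : 'M[K]_n :=
  map_mx (fun c => tofrac c%:P) M.

Definition word_eval (T : choiceType) (m : T -> 'M[K]_n) (u : word T) :
    'M[K]_n :=
  foldr (fun l M => (if l.2 then m l.1 else invmx (m l.1)) *m M) 1%:M u.

Definition fox_eval (T : choiceType) (m : T -> 'M[K]_n)
    (s : seq (int * word T)) : 'M[K]_n :=
  \sum_(c <- s) c.1%:~R *: word_eval m c.2.

Variables (q : nat) (phi : knot_group q -> 'M[C]_n).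

Definition twisted_gen (x : bool) : 'M[K]_n :=
  ratvar *: const_frac_mx (phi (pgen (knot_rels q) x)).

Definition twisted_Ahat : 'M[K]_n :=
  1%:M + (twisted_gen gen_a - 1%:M)
           *m fox_eval twisted_gen (fox gen_a (knot_word q)).

(* The quotient is taken in C(t), where it is meaningful because
   det(t phi(b) - I) = +-1 at t = 0. *)
Definition twisted_alexander : K :=
  \det twisted_Ahat / \det (twisted_gen gen_b - 1%:M).

(* P is the l-twisted Alexander polynomial up to a factor +-t^(rl), l = n. *)
Definition is_twisted_alexander (P : K) : Prop :=
  exists (s : bool) (r : int),
    P = (-1) ^+ s * ratvar ^ (r * n%:Z) * twisted_alexander.

End TwistedAlexander.

(* Laurent d p denotes the integer Laurent polynomial t^d * p(t).  Encodings
   are not unique, so equality and congruence go through lcoef. *)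
Record laurent := Laurent { lshift : int; lnum : {poly int} }.

Definition lcoef (f : laurent) (k : int) : int :=
  if k - lshift f is Posz i then (lnum f)`_i else 0.

Definition lpoly (p : {poly int}) : laurent := Laurent 0 p.

Definition lmul (f g : laurent) : laurent :=
  Laurent (lshift f + lshift g) (lnum f * lnum g).

Definition lexp (f : laurent) (m : nat) : laurent :=
  Laurent (lshift f *+ m) (lnum f ^+ m).

(* The value of f at a nonzero u. *)
Definition leval (K : fieldType) (u : K) (f : laurent) : K :=
  u ^ lshift f * (map_poly intr (lnum f)).[u].

Definition lcongr (l : nat) (f g : laurent) : Prop :=
  forall k : int, (lcoef f k = lcoef g k %[mod l])%Z.

(* 1 - t + t^2 - ... + t^(q-1), for q odd *)
Definition torus_alexander (q : nat) : {poly int} :=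
  \sum_(i < q) (- 'X) ^+ i.

(* D is the Alexander polynomial of the (2,q)-torus knot, up to +-t^r. *)
Definition is_alexander (q : nat) (D : laurent) : Prop :=
  exists (s : bool) (r : int),
    lcoef D =1 lcoef (Laurent r ((-1) ^+ s * torus_alexander q)).

(* Main.v *)
Require Import Defs.
From HB Require Import structures.
From mathcomp Require Import all_boot all_order all_algebra.
From mathcomp Require Import boolp reals complex.
From mathcomp Require Import zify ring.

Set Implicit Arguments.
Unset Strict Implicit.
Unset Printing Implicit Defensive.

Import Order.TTheory GRing.Theory Num.Theory.
Local Open Scope ring_scope.

(* Put A = t phi(a), B = t phi(b), w = (BA)^((q-1)/2) and l = 2h+1.  Since
   dw/da (AB - I) = wB - B and A wB = wB B, one finds
     Ahat (AB - I) = (I + wB)(B - I),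
   so the twisted polynomial is det(I + wB) / det(AB - I).  A surjection onto
   D_l sends a and b to distinct reflections; hence wB is t^q times a
   reflection and AB is t^2 times a generating rotation, and the quotient is
     (1 + t^q)(1 - t^(2q))^h / (t^(2l) - 1).
   It splits as required with f = (1 + t)(1 + t^q)^h / (1 + t^l), a polynomial
   as l divides q, and (1 + t)^l = 1 + t^l mod l gives the congruence.

   The matrices of dihedral elements are those of the maps i -> u i + d of
   Z/l: rotations have u = 1 and reflections u = -1. *)

(** * Matrices of affine maps of Z/l and their determinants *)

Section AffineMatrices.
Variables (F : comNzRingType) (n : nat).
Local Notation Zl := 'Z_n.+2.
Implicit Types u d : Zl.

(** The index type ['I_n.+2] is convertible to the ring ['Z_n.+2], so indices can be computed with
    modulo [n.+2]. *)
Definition affine_mx u d : 'M[F]_n.+2 := \matrix_(i, j) (i == u * j + d :> Zl)%:R.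

Lemma affine_mxM u d u' d' :
  affine_mx u d * affine_mx u' d' = affine_mx (u * u') (u * d' + d).
Proof.
apply/matrixP=> i j; rewrite !mxE (bigD1 (u' * j + d')) //= big1 => [|k kE].
  by rewrite !mxE eqxx mulr1 addr0 mulrDr mulrA addrA.
by rewrite !mxE (negPf kE) mulr0.
Qed.

Lemma affine_mx1 : affine_mx 1 0 = 1.
Proof. by apply/matrixP=> i j; rewrite !mxE mul1r addr0. Qed.

Lemma affine_mx_inj u d u' d' :
  affine_mx u d = affine_mx u' d' -> u = u' /\ d = d'.
Proof.
have eq1 : (1 == 0 :> F) = false by rewrite oner_eq0.
move=> E; have ev (j : Zl) : u * j + d = u' * j + d'.
  move/matrixP/(_ (u * j + d) j): E; rewrite !mxE eqxx.
  by case: eqP => // _ /eqP; rewrite eq1.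
have dd : d = d' by have:= ev 0; rewrite !mulr0 !add0r.
by split=> //; have:= ev 1; rewrite !mulr1 dd; apply: addIr.
Qed.

Lemma flip_affine : \matrix_(i, j) (i == rev_ord j)%:R = affine_mx (-1) (-1).
Proof.
apply/matrixP=> i j; rewrite !mxE; congr (_ == _)%:R.
have: rev_ord j + (j + 1 : Zl) = 0 :> Zl.
  apply/val_inj => /=; rewrite (modn_small (isT : 1 < n.+2)%N) modnDmr subSS.
  have -> : (n.+1 - j + (j + 1))%N = n.+2 by have := ltn_ord j; lia.
  by rewrite modnn.
by move/eqP; rewrite mulN1r addr_eq0 opprD => /eqP ->.
Qed.

Lemma shift_affine : \matrix_(i, j) (i == ordS j)%:R = affine_mx 1 1.
Proof.
apply/matrixP=> i j; rewrite !mxE; congr (_ == _)%:R.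
by rewrite mul1r (add_Zp_1 (j : Zl)).
Qed.

Lemma det_similar (U V A : 'M[F]_n.+2) : U * V = 1 -> \det (U * A * V) = \det A.
Proof.
by move=> UV; rewrite !detM mulrAC -detM UV det1 mul1r.
Qed.

(** The flip swaps [h] pairs of indices and fixes the middle index [h]: each pair contributes a
    factor [1 - s ^+ 2], the fixed index [1 + s]. *)
Lemma det_flip (h : nat) (s : F) (m := h.*2.+1) :
  \det (1%:M + s *: \matrix_(i < m, j < m) (i == rev_ord j)%:R)
  = (1 + s) * (1 - s ^+ 2) ^+ h.
Proof.
set J := \matrix_(i, j) _.
pose JD : 'M[F]_m := \matrix_(i, j) ((i == rev_ord j) && (h < j)%N)%:R.
pose D : 'M[F]_m := \matrix_(i, j) ((i == j) && (h < j)%N)%:R.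
have JJD : J *m JD = D.
  apply/matrixP=> i j; rewrite !mxE (bigD1 (rev_ord j)) //= big1 => [|k kE].
    by rewrite !mxE eqxx rev_ordK /= addr0 -natrM mulnb.
  by rewrite !mxE (negPf kE) mulr0.
have revE (i j : 'I_m) : (i == rev_ord j) = (i + j == h.*2)%N.
  by rewrite -val_eqE /=; have := ltn_ord i; have := ltn_ord j; rewrite /m; lia.
have triU : is_trig_mx (1%:M - s *: JD)^T.
  apply/is_trig_mxP=> i j ij; rewrite !mxE revE -val_eqE /= gtn_eqF //.
  have -> : (j + i == h.*2)%N && (h < i)%N = false by lia.
  by rewrite mulr0 subr0.
have detU : \det (1%:M - s *: JD) = 1.
  rewrite -det_tr (det_trig triU) big1 // => i _; rewrite !mxE revE eqxx.
  have -> : (i + i == h.*2)%N && (h < i)%N = false by lia.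
  by rewrite mulr0 subr0.
(* Subtracting s times the right half JD of J makes the matrix triangular. *)
have TE : (1%:M + s *: J) *m (1%:M - s *: JD)
          = 1%:M + s *: (J - JD) - s ^+ 2 *: D.
  rewrite mulmxDl mul1mx -scalemxAl mulmxBr mulmx1 -scalemxAr JJD.
  by rewrite !scalerBr scalerA expr2 !addrA; congr (_ - _); rewrite addrAC.
have triT : is_trig_mx (1%:M + s *: (J - JD) - s ^+ 2 *: D).
  apply/is_trig_mxP=> i j ij; rewrite !mxE !revE -!val_eqE /=.
  rewrite ltn_eqF // mulr0 subr0.
  case: (eqVneq (i + j)%N h.*2) => [ijE|_]; last by rewrite subrr mulr0 addr0.
  have -> : (h < j)%N by lia.
  by rewrite subrr mulr0 addr0.
rewrite -[LHS]mulr1 -[X in _ * X]detU -det_mulmx TE det_trig //.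
(* The diagonal of the triangular product: columns left of [h] keep the entry 1, column [h] gains
   [s] from the fixed point of [J], and columns right of it gain [- s ^+ 2] from [D]. *)
pose G i := if (i < h)%N then 1 else if i == h then 1 + s else 1 - s ^+ 2.
rewrite (eq_bigr (fun i : 'I_m => G i)) => [|i _]; last first.
  rewrite !mxE revE eqxx /G /= addnn (inj_eq double_inj) andbC.
  by case: ltngtP => _; rewrite /= ?(subrr, subr0, mulr0, mulr1, addr0).
have -> : \prod_(i < m) G i = \prod_(0 <= i < m) G i by rewrite big_mkord.
rewrite (@big_cat_nat _ _ _ h) //=; last by rewrite /m; lia.
rewrite [X in X * _]big_nat_cond [X in X * _]big1 => [|i]; last first.
  by rewrite /G andbT /= => ->.
rewrite mul1r big_ltn /G ?ltnn ?eqxx; last by rewrite /m; lia.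
congr (_ * _); rewrite big_nat_cond (eq_bigr (fun=> 1 - s ^+ 2)) => [|i].
  by rewrite -big_nat_cond prodr_const_nat; congr (_ ^+ _); rewrite /m; lia.
by rewrite andbT => /andP[hi _]; rewrite ltnNge ltnW // (gtn_eqF hi).
Qed.

Lemma det_reflection s d h :
    n.+2 = h.*2.+1 -> (2 : Zl) \is a GRing.unit ->
  \det (1%:M + s *: affine_mx (-1) d) = (1 + s) * (1 - s ^+ 2) ^+ h.
Proof.
move=> nE U2; rewrite -det_flip -nE flip_affine.
(* Conjugation by the translation by [e] changes [d] into [d + 2 * e]; this [e] makes it [-1], which
   is the flip. *)
pose e : Zl := (- 1 - d) / 2.
have UV : affine_mx 1 e * affine_mx 1 (- e) = 1.
  by rewrite affine_mxM !mul1r addNr affine_mx1.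
have <- : affine_mx 1 e * affine_mx (-1) d * affine_mx 1 (- e) = affine_mx (-1) (-1).
  rewrite !affine_mxM !mul1r mulr1 mulN1r opprK addrCA -mulr2n -mulr_natr.
  by rewrite divrK // addrC subrK.
by rewrite -(det_similar _ UV) mulrDr mulrDl mulr1 UV -scalerAr -scalerAl.
Qed.

(** Entries are compared one by one because [companionmx p] has size [(size p).-1], which need not
    be convertible to [m]. *)
Lemma char_poly_companion m (A : 'M[F]_m) (p : {poly F}) :
    p \is monic -> m = (size p).-1 ->
    (forall i j, A i j = if i == m.-1 :> nat then - p`_j
                         else (i.+1 == j :> nat)%:R) ->
  char_poly A = p.
Proof.
move=> p_monic mE; subst m => AE; rewrite -[RHS](companionmxK p_monic).
by congr char_poly; apply/matrixP=> i j; rewrite AE mxE.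
Qed.

Lemma horner_char_poly m (A : 'M[F]_m) x :
  (char_poly A).[x] = \det (x%:M - A).
Proof.
rewrite -/(horner_eval x _) -det_map_mx; congr (\det _).
by apply/matrixP=> i j; rewrite !mxE rmorphB rmorphMn /= !/(horner_eval _ _) hornerX hornerC.
Qed.

(** The shift by [-1] is the companion matrix of ['X ^+ n.+2 - 1], and scaling by the unit [- d]
    conjugates it to the shift by [d]. *)
Lemma det_rotation x d :
  d \is a GRing.unit -> \det (x%:M - affine_mx 1 d) = x ^+ n.+2 - 1.
Proof.
move=> Ud.
have chi : char_poly (affine_mx 1 (-1)) = 'X ^+ n.+2 - 1.
  apply: char_poly_companion.
  - by rewrite -polyC1 monicXnsubC.
  - by rewrite -polyC1 size_XnsubC.
  move=> i j; rewrite mxE coefB coefXn coef1 mul1r -subr_eq opprK.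
  rewrite -val_eqE /Zp_trunc /=.
  have lti := ltn_ord i; have ltj := ltn_ord j.
  rewrite (modn_small (isT : 1 < n.+2)%N) addn1.
  case: (eqVneq (i : nat) n.+1) => [->|ni]; last by rewrite modn_small //; lia.
  by rewrite modnn (ltn_eqF ltj) sub0r opprK eq_sym.
have UV : affine_mx (- d) 0 * affine_mx (- d^-1) 0 = 1.
  by rewrite affine_mxM mulrNN divrr // mulr0 addr0 affine_mx1.
have <- : affine_mx (- d) 0 * (x%:M - affine_mx 1 (-1)) * affine_mx (- d^-1) 0
          = x%:M - affine_mx 1 d.
  rewrite mulrBr mulrBl -scalemx1 -[_ * (x *: _)]scalerAr mulr1 -scalerAl UV.
  rewrite !affine_mxM !mulr1 mulrNN divrr //.
  by rewrite mulr0 add0r addr0 mulrN1 opprK.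
by rewrite det_similar // -horner_char_poly chi !hornerE.
Qed.

End AffineMatrices.

(** * Matrix representations of presented groups *)

Section Representations.
Variables (C : fieldType) (n : nat).

(** Induction on a word; the image of an inverse letter is reached as a right inverse of the image
    of its generator. *)
Lemma rep_presented_ind (T : choiceType) (rels : seq (word T * word T))
    (phi : presented rels -> 'M[C]_n) (Q : 'M[C]_n -> Prop) :
    is_matrix_rep phi ->
    Q 1%:M -> (forall M N, Q M -> Q N -> Q (M *m N)) ->
    (forall M N, Q M -> M *m N = 1%:M -> Q N) ->
    (forall x, Q (phi (pgen rels x))) ->
  forall g, Q (phi g).
Proof.
move=> [phi1 phiM] Q1 QM QV Qgen; elim/pclass_ind; elim=> [|[x s] u IHu].
  by have -> : pclass rels [::] = 1%g by []; rewrite phi1.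
have -> : pclass rels ((x, s) :: u) = (pclass rels [:: (x, s)] * pclass rels u)%g.
  exact/esym/pmulE.
rewrite phiM; apply: QM => //; case: s => //; first exact: Qgen.
apply: QV (Qgen x) _; rewrite -phiM -phi1; congr phi.
apply: etrans (pmulE _ _ _) _; apply/pclassP; exact: same_cancel.
Qed.

End Representations.

Lemma rep_knot_rel (C : fieldType) (n q : nat) (phi : knot_group q -> 'M[C]_n.+1)
    (a := phi (pgen (knot_rels q) gen_a)) (b := phi (pgen (knot_rels q) gen_b)) :
    is_matrix_rep phi ->
  a * (b * a) ^+ q.-1./2 = (b * a) ^+ q.-1./2 * b.
Proof.
move=> [phi1 phiM].
have phi_cons x u : phi (pclass _ ((x, true) :: u))
    = phi (pgen (knot_rels q) x) * phi (pclass _ u).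
  by rewrite -[_ * _]phiM; congr phi; exact/esym/pmulE.
have phi_w : phi (pclass _ (knot_word q)) = (b * a) ^+ q.-1./2.
  rewrite /knot_word; elim: (_./2) => [|k IHk].
    by have -> : pclass (knot_rels q) [::] = 1%g by []; rewrite phi1.
  by rewrite [flatten _]/= [LHS]phi_cons [X in _ * X]phi_cons IHk exprS -mulrA.
rewrite -phi_w -[LHS]phi_cons -[RHS]phiM; congr phi.
apply: etrans (esym (pmulE _ _ _)); apply/pclassP.
by rewrite cats1; apply: same_rel; rewrite inE.
Qed.

(** * The Fox derivative of the knot word *)

Section FoxEval.
Variables (C : fieldType) (n : nat).
Local Notation K := {fraction {poly C}}.
Variable m : bool -> 'M[K]_n.+1.
Local Notation A := (m gen_a).
Local Notation B := (m gen_b).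

(** Putting [b a] in front of a word turns its derivative d into B + BA d. Hence dw/da is the sum of
    the [(B * A) ^+ i * B], and its product with [A * B - 1] telescopes since B(AB) = (BA)B. *)
Lemma fox_eval_knot_word q :
  fox_eval m (fox gen_a (knot_word q)) * (A * B - 1)
  = (B * A) ^+ q.-1./2 * B - B.
Proof.
rewrite /knot_word; elim: (_./2) => [|k IHk] /=.
  by rewrite /fox_eval big_nil mul0r mul1r subrr.
set s := fox _ _ in IHk *.
have -> : fox_eval m ((1, [:: (gen_b, true)])
     :: [seq (c.1, (gen_b, true) :: c.2)
       | c <- [seq (c.1, (gen_a, true) :: c.2) | c <- s]]) = B + B * A * fox_eval m s.
  rewrite /fox_eval big_cons /= mulmx1 scale1r -map_comp big_map /= mulr_sumr.
  by congr (_ + _); apply: eq_bigr => c _; rewrite -scalerAr; congr (_ *: _); rewrite -[RHS]mulrA.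
rewrite mulrDl -(mulrA (B * A)) IHk exprS !mulrBr mulr1 !mulrA.
by rewrite addrC addrA subrK.
Qed.

End FoxEval.

Lemma ratvar_unity (C : fieldType) (d : nat) : (0 < d)%N -> ratvar C ^+ d != 1.
Proof.
move=> d_gt0; rewrite -subr_eq0 /ratvar -tofracXn -tofrac1 -tofracB tofrac_eq0.
by rewrite -polyC1 -size_poly_eq0 size_XnsubC.
Qed.

Lemma eq_div_of_cross (F : fieldType) (x y z e : F) :
  y != 0 -> e != 0 -> x * e = z * y -> x / y = z / e.
Proof. by move=> y0 e0 xE; apply/eqP; rewrite eqr_div // xE. Qed.

(** * The twisted polynomial when both generators act as reflections *)

Section TwistedDihedral.
Variables (C : fieldType) (n q h : nat) (phi : knot_group q -> 'M[C]_n.+2).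
Local Notation Zl := 'Z_n.+2.
Local Notation t := (ratvar C).
Variables alpha beta : Zl.

Lemma const_frac_affine (u d : Zl) :
  const_frac_mx (affine_mx C u d) = affine_mx {fraction {poly C}} u d.
Proof.
apply/matrixP=> i j; rewrite !mxE; case: (_ == _); first exact: tofrac1.
exact: tofrac0.
Qed.

Lemma twisted_alexander_dihedral :
    odd q ->
    n.+2 = h.*2.+1 -> (2 : Zl) \is a GRing.unit ->
    beta - alpha \is a GRing.unit -> (beta - alpha) *+ q = 0 ->
    phi (pgen (knot_rels q) gen_a) = affine_mx C (-1) alpha ->
    phi (pgen (knot_rels q) gen_b) = affine_mx C (-1) beta ->
  twisted_alexander phi
  = (1 + t ^+ q) * (1 - t ^+ (q * 2)) ^+ h / (t ^+ (n.+2 * 2) - 1).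
Proof.
move=> q_odd nE U2 Uba bq0 phia phib.
set m := twisted_gen phi; set A := m gen_a; set B := m gen_b.
pose Ahat : 'M_n.+2 := 1 + (A - 1) * fox_eval m (fox gen_a (knot_word q)).
have -> : twisted_alexander phi = \det Ahat / \det (B - 1) by [].
have AE : A = t *: affine_mx _ (-1) alpha.
  by rewrite /A /m /twisted_gen phia const_frac_affine.
have BE : B = t *: affine_mx _ (-1) beta.
  by rewrite /B /m /twisted_gen phib const_frac_affine.
set k := q.-1./2; set w := (B * A) ^+ k.
have qE : q = k.*2.+1 by rewrite /k; lia.
have BAE : B * A = t ^+ 2 *: affine_mx _ 1 (beta - alpha).
  by rewrite AE BE -scalerAl -scalerAr scalerA affine_mxM mulrNN mulr1 mulN1r addrC.
have ABE : A * B = t ^+ 2 *: affine_mx _ 1 (alpha - beta).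
  by rewrite AE BE -scalerAl -scalerAr scalerA affine_mxM mulrNN mulr1 mulN1r addrC.
have wE : w = t ^+ k.*2 *: affine_mx _ 1 ((beta - alpha) *+ k).
  rewrite /w BAE; elim: k {w qE} => [|k IHk]; first by rewrite mulr0n affine_mx1 scale1r.
  rewrite exprS IHk -scalerAl -scalerAr scalerA affine_mxM !mul1r -exprD.
  by rewrite mulrS addrC.
have wBE : w * B = t ^+ q *: affine_mx _ (-1) (beta + (beta - alpha) *+ k).
  by rewrite wE BE -scalerAl -scalerAr scalerA affine_mxM !mul1r -exprSr -qE.
(* This is the knot relation multiplied by [B]: the translation parts of the two sides differ, up to
   sign, by [(beta - alpha) *+ q], which [bq0] makes zero. *)
have AwB : A * (w * B) = w * B * B.
  rewrite wBE AE BE -!scalerAl -!scalerAr !scalerA !affine_mxM mulrC mulrNN mulr1.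
  have -> // : -1 * (beta + (beta - alpha) *+ k) + alpha
               = -1 * beta + (beta + (beta - alpha) *+ k).
  apply/eqP; rewrite -subr_eq0 -oppr_eq0 -bq0 qE mulrS -addnn mulrnDr !mulN1r.
  apply/eqP; ring.
have AhatE : Ahat * (A * B - 1)
             = (1 + w * B) * (B - 1).
  rewrite /Ahat mulrDl mul1r -mulrA fox_eval_knot_word -/A -/B -/k -/w.
  rewrite mulrBr !mulrBl AwB !mul1r mulrDl mul1r mulrBr mulr1.
  rewrite [X in _ + X]addrC opprB addrA; congr (_ + _).
  by rewrite addrC addrA subrK.
have dAhat := congr1 determinant AhatE.
rewrite !detM wBE (det_reflection _ _ nE U2) -exprM in dAhat.
have dB : \det (B - 1) != 0.
  have -> : B - 1 = - 1 *: (1 + (- t) *: affine_mx _ (-1) beta).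
    by rewrite scaleN1r BE opprD scaleNr opprK addrC.
  rewrite detZ (det_reflection _ _ nE U2) sqrrN.
  apply: mulf_neq0; first by rewrite expf_neq0 // oppr_eq0 oner_eq0.
  apply: mulf_neq0; first by rewrite subr_eq0 eq_sym -[t]expr1 ratvar_unity.
  by rewrite expf_neq0 // subr_eq0 eq_sym ratvar_unity.
have t0 : t != 0 by rewrite tofrac_eq0 polyX_eq0.
(* Factoring out [- (t ^+ 2)] leads to [det_rotation] at [t ^- 2]. The size is odd, so the sign
   survives and turns [1 - t ^+ (n.+2 * 2)] around. *)
have dAB : \det (A * B - 1) = t ^+ (n.+2 * 2) - 1.
  have -> : A * B - 1 = - (t ^+ 2) *: ((t ^- 2)%:M - affine_mx _ 1 (alpha - beta)).
    rewrite scalerBr scale_scalar_mx mulNr divff ?expf_neq0 //.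
    by rewrite scaleNr opprK ABE addrC raddfN.
  rewrite detZ det_rotation; last by rewrite -opprB unitrN.
  have : odd n.+2 by rewrite nE /= odd_double.
  move: n.+2 => p p_odd.
  rewrite exprNn -signr_odd p_odd expr1 mulN1r mulNr mulrBr mulr1 exprVn.
  by rewrite divff ?expf_neq0 // opprB -exprM mulnC.
have e0 : t ^+ (n.+2 * 2) - 1 != 0 by rewrite subr_eq0 ratvar_unity.
by rewrite dAB in dAhat; exact: eq_div_of_cross dB e0 dAhat.
Qed.
End TwistedDihedral.

(** * Images of the knot generators in the dihedral group *)

Section DihedralImages.
Variables (C : fieldType) (n : nat).
Local Notation Zl := 'Z_n.+2.

(** [S] cuts out a group of affine maps that is to contain the whole image. When u^2 = 1, the
    inverse of i -> u i + d is i -> u i - u d. *)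
Lemma rep_affine_ind (T : choiceType) (rels : seq (word T * word T))
    (phi : presented rels -> 'M[C]_n.+2) (S : Zl -> Zl -> Prop) :
    is_matrix_rep phi ->
    (forall u d, S u d -> u * u = 1) ->
    S 1 0 -> (forall u d u' d', S u d -> S u' d' -> S (u * u') (u * d' + d)) ->
    (forall u d, S u d -> S u (- (u * d))) ->
    (forall x, exists u d, S u d /\ phi (pgen rels x) = affine_mx C u d) ->
  forall g, exists u d, S u d /\ phi g = affine_mx C u d.
Proof.
move=> phi_rep Ssqr S1 SM SV Sgen.
apply: (rep_presented_ind (Q := fun M => exists u d, S u d /\ M = affine_mx C u d)) => //.
- by exists 1, 0; rewrite affine_mx1.
- move=> _ _ [u [d [Sud ->]]] [u' [d' [Sud' ->]]].
  by exists (u * u'), (u * d' + d); split; [exact: SM | exact: affine_mxM].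
move=> _ N [u [d [Sud ->]]] MN; exists u, (- (u * d)); split; first exact: SV.
have VM : affine_mx C u (- (u * d)) *m affine_mx C u d = 1%:M.
  by rewrite [LHS]affine_mxM (Ssqr _ _ Sud) subrr affine_mx1.
by rewrite -[N]mul1mx -VM -mulmxA MN mulmx1.
Qed.

Lemma unitZ_prime (x : Zl) : prime n.+2 -> x != 0 -> x \is a GRing.unit.
Proof.
move=> p_prime x0; rewrite -(natr_Zp x) unitZpE // prime_coprime // gtnNdvd //.
by rewrite lt0n.
Qed.

Lemma rep_comp (G H : groupType) (pi : H -> 'M[C]_n.+2)
    (rho : {multiplicative G -> H}) :
  is_matrix_rep pi -> is_matrix_rep (pi \o rho).
Proof.
case=> pi1 piM; split=> [|g h] /=; last by rewrite gmulfM.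
have -> : rho 1%g = 1%g; last by [].
by apply: (@mulgI _ (rho 1%g)); rewrite -gmulfM !mulg1.
Qed.

(** The knot relation forces equal linear parts. Two rotations would generate only rotations and
    miss [x]; two equal reflections would generate a group of order two and miss [y]. So the
    reflections differ, and a nonzero difference is a unit modulo a prime. *)
Lemma knot_dihedral_images (q : nat)
    (pi : dihedral_group n.+2 -> 'M[C]_n.+2)
    (rho : {multiplicative knot_group q -> dihedral_group n.+2}) :
    prime n.+2 -> odd n.+2 -> is_matrix_rep pi ->
    pi (dihedral_x n.+2) = flip_mx _ n.+2 ->
    pi (dihedral_y n.+2) = shift_mx _ n.+2 ->
    (forall d, exists g, rho g = d) ->
  exists alpha beta : Zl,
    [/\ beta - alpha \is a GRing.unit,
        pi (rho (pgen (knot_rels q) gen_a)) = affine_mx C (-1) alpha &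
        pi (rho (pgen (knot_rels q) gen_b)) = affine_mx C (-1) beta].
Proof.
move=> l_prime l_odd pi_rep pi_x pi_y rho_surj.
have pi_xE : pi (dihedral_x n.+2) = affine_mx C (-1) (-1).
  by rewrite pi_x; exact: flip_affine.
have pi_yE : pi (dihedral_y n.+2) = affine_mx C 1 1.
  by rewrite pi_y; exact: shift_affine.
have N11 : -1 <> 1 :> Zl.
  move/eqP; rewrite eq_sym -subr_eq0 opprK => /eqP /(congr1 val).
  by case: (n) l_odd.
pose S0 (u d : Zl) := u = 1 \/ u = -1.
have imD : forall g, exists u d, S0 u d /\ pi g = affine_mx C u d.
  apply: rep_affine_ind => //.
  - by move=> u _ [] ->; rewrite ?mulrNN mulr1.
  - by left.
  - by move=> u d u' d' [] -> [] ->; rewrite ?mulrNN ?mul1r ?mulr1; [left|right|right|left].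
  by case; [exists 1, 1 | exists (-1), (-1)]; split=> //; [left|right].
set a := pgen _ gen_a; set b := pgen _ gen_b.
have phi_rep := rep_comp rho pi_rep.
have [ua [alpha [Sa piaE]]] := imD (rho a).
have [ub [beta [Sb pibE]]] := imD (rho b).
have phi_ind := rep_affine_ind phi_rep.
(* Linear parts multiply and commute, so the part [uw] of the image of w, whose square is 1, cancels
   from the relation. *)
have uab : ua = ub.
  have := rep_knot_rel phi_rep; rewrite /= -/a -/b piaE pibE.
  rewrite [affine_mx C ub beta * _]affine_mxM.
  have [uw [dw [uw2 ->]]] : exists u d : Zl, u * u = 1 /\
      affine_mx C (ub * ua) (ub * alpha + beta) ^+ q.-1./2 = affine_mx C u d.
    elim: (_./2) => [|k [u [d [u2 IHk]]]].
      by exists 1, 0; rewrite expr0 mulr1 affine_mx1.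
    rewrite exprS IHk affine_mxM; do 2 eexists; split; last by [].
    rewrite mulrACA u2 mulr1 mulrACA.
    by case: Sa Sb => -> [] ->; rewrite ?mulrNN !mulr1.
  rewrite !affine_mxM => /affine_mx_inj[E _].
  by rewrite -[ua]mulr1 -uw2 mulrA E mulrAC uw2 mul1r.
subst ub; have [ua1|uaN1] := Sa.
  have [g gE] := rho_surj (dihedral_x _).
  have [|||||u [d [-> ]]] := phi_ind (fun u _ => u = 1) _ _ _ _ _ g.
  - by move=> u _ ->; rewrite mulr1.
  - by [].
  - by move=> u d u' d' -> ->; rewrite mulr1.
  - by [].
  - by case; [exists ua, beta | exists ua, alpha].
  by rewrite /= gE pi_xE => /affine_mx_inj[].
exists alpha, beta; rewrite piaE pibE uaN1; split=> //.
apply: unitZ_prime => //; rewrite subr_eq0; apply/eqP => ab.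
have [g gE] := rho_surj (dihedral_y _).
(* The group of order two generated by the common reflection; the image of [y], translation by 1,
   lies outside it. *)
pose S (u d : Zl) := u = 1 /\ d = 0 \/ u = -1 /\ d = alpha.
have [|||||u [d [Sud]]] := phi_ind S _ _ _ _ _ g.
- by move=> u _ [[-> _]|[-> _]]; rewrite ?mulrNN mulr1.
- by left.
- move=> u d u' d' [[-> ->]|[-> ->]] [[-> ->]|[-> ->]];
    rewrite ?mulrNN !(mul1r, mulr1, mulN1r, addr0, oppr0, add0r, addNr); by [left|right].
- by move=> u d [[-> ->]|[-> ->]]; rewrite !(mul1r, mulN1r, opprK, oppr0); [left|right].
- by case; [exists ua, beta | exists ua, alpha]; split=> //; right; rewrite ?ab.
rewrite /= gE pi_yE => /affine_mx_inj[uE dE].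
case: Sud => -[uE' dE'].
  by move: dE'; rewrite -dE => /eqP; rewrite oner_eq0.
by apply: N11; rewrite -uE'.
Qed.

End DihedralImages.

(** * The factor f, the splitting of the quotient, and the congruence *)

Lemma alternating_geometric (R : comNzRingType) (z : R) m :
  odd m ->
  (1 + z) * \sum_(i < m) (- z) ^+ i = 1 + z ^+ m.
Proof.
move=> m_odd; have := subrX1 (- z) m; rewrite exprNn -signr_odd m_odd expr1 mulN1r -!opprD mulNr.
by move/oppr_inj => E; rewrite addrC -E addrC.
Qed.

Lemma rmorph_alternating (R S : comNzRingType) (g : {rmorphism R -> S}) (x : R) k :
  g (\sum_(i < k) (- x) ^+ i) = \sum_(i < k) (- g x) ^+ i.
Proof.
by rewrite rmorph_sum; apply: eq_bigr => i _; rewrite rmorphXn rmorphN.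
Qed.

Section TorusFactor.
Variables (l m h : nat).
Hypothesis m_odd : odd m.

(** The polynomial f, with (1 + x^(lm)) / (1 + x^l) written as an alternating sum; this uses up one
    of the [h.+1] powers, where l = 2(h+1) + 1. The ring is arbitrary so that f can be taken over
    the integers, over ['F_l] and at [t] and [- t]. *)
Definition torus_factor (R : comNzRingType) (x : R) : R :=
  (1 + x) * (\sum_(i < m) (- x ^+ l) ^+ i) * (1 + x ^+ (l * m)) ^+ h.

Lemma torus_factorE (R : comNzRingType) (x : R) :
  (1 + x ^+ l) * torus_factor x = (1 + x) * (1 + x ^+ (l * m)) ^+ h.+1.
Proof.
by rewrite /torus_factor !mulrA [_ * (1 + x)]mulrC -!mulrA; congr (_ * _);
  rewrite mulrA alternating_geometric // -exprM exprS.
Qed.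

Lemma rmorph_torus_factor (R S : comNzRingType) (g : {rmorphism R -> S}) (x : R) :
  g (torus_factor x) = torus_factor (g x).
Proof.
rewrite /torus_factor !rmorphM rmorphXn !rmorphD !rmorph1 rmorphXn.
by rewrite rmorph_alternating rmorphXn.
Qed.

(** Put T = t^(lm) and L = t^l. The exponents are odd, so t -> -t negates both, and f(t) f(-t) = (1
    - t^2)(1 - T^2)^(h+1) / (1 - L^2). The remaining factor is (1 + T) / (t^2 - 1). *)
Lemma twisted_factorization (F : fieldType) (t : F) :
    odd l -> t ^+ 2 != 1 -> t ^+ (l * 2) != 1 ->
  (1 + t ^+ (l * m)) * (1 - t ^+ (l * m * 2)) ^+ h.+1 / (t ^+ (l * 2) - 1)
  = (\sum_(i < l * m) (- t) ^+ i) / (t - 1) * torus_factor t * torus_factor (- t).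
Proof.
move=> l_odd t2 tl2.
have lm_odd : odd (l * m) by rewrite oddM l_odd.
have DE := alternating_geometric t lm_odd.
have fE := torus_factorE t; have := torus_factorE (- t).
rewrite ![(- t) ^+ _]exprNn -!(signr_odd _ l) -!(signr_odd _ (l * m)).
rewrite l_odd lm_odd !expr1 !mulN1r => fNE.
rewrite exprM in tl2 *; rewrite [t ^+ (l * m * 2)]exprM.
have TE : 1 - (t ^+ (l * m)) ^+ 2 = (1 + t ^+ (l * m)) * (1 - t ^+ (l * m)) by ring.
rewrite TE exprMn.
(* Sums and powers become atoms, which leaves [field] a small rational identity. *)
move: DE fE fNE; move: (\sum_(i < _) _) (torus_factor t) (torus_factor (- t)) => D f1 f2.
move: (t ^+ l) tl2 (t ^+ (l * m)) {TE} => L L2 T.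
move: ((1 + T) ^+ h.+1) ((1 - T) ^+ h.+1) => a b DE fE fNE.
have [tp tm] : 1 + t != 0 /\ 1 - t != 0.
  apply/andP; rewrite -negb_or -mulf_eq0.
  by have -> : (1 + t) * (1 - t) = 1 - t ^+ 2 by [ring]; rewrite subr_eq0 eq_sym.
have [Lp Lm] : 1 + L != 0 /\ 1 - L != 0.
  apply/andP; rewrite -negb_or -mulf_eq0.
  by have -> : (1 + L) * (1 - L) = 1 - L ^+ 2 by [ring]; rewrite subr_eq0 eq_sym.
have {}DE : D = (1 + T) / (1 + t) by rewrite -DE mulrC mulKf.
have {}fE : f1 = (1 + t) * a / (1 + L) by rewrite -fE mulrC mulKf.
have {}fNE : f2 = (1 - t) * b / (1 - L) by rewrite -fNE mulrC mulKf.
rewrite DE fE fNE; field.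
by rewrite Lm Lp tp -(opprB 1 t) oppr_eq0 tm subr_eq0 L2.
Qed.

(** After multiplication by the nonzero (1 + X^l)(1 + X)^(h+1), the sides are (1 + X)^(2h+3) and 1 +
    X^l, each times (1 + X^(lm))^(h+1). They agree by Frobenius, as 2h + 3 = l. *)
Lemma torus_factor_congr :
    prime l -> odd l -> l = h.+1.*2.+1 ->
  ('X + 1) ^+ h.+1 * torus_factor 'X = (\sum_(i < l * m) (- 'X) ^+ i) ^+ h.+1 :> {poly 'F_l}.
Proof.
move=> l_prime l_odd lE.
have nz d : (0 < d)%N -> 1 + 'X^d != 0 :> {poly 'F_l}.
  by move=> d0; rewrite addrC -polyC1 -size_poly_eq0 size_XnaddC.
have l0 := prime_gt0 l_prime.
apply: (mulfI (mulf_neq0 (nz _ l0) (expf_neq0 h.+1 (nz 1%N isT)))).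
have frob : (1 + 'X) ^+ l = 1 + 'X^l :> {poly 'F_l}.
  by rewrite exprDn_pchar ?expr1n // pnatE // pchar_poly pchar_Fp.
have -> : (1 + 'X^l) * (1 + 'X^1) ^+ h.+1 * (('X + 1) ^+ h.+1 * torus_factor 'X)
  = (1 + 'X) ^+ h.+1 * (1 + 'X) ^+ h.+1 * ((1 + 'X^l) * torus_factor 'X) :> {poly 'F_l}.
  by rewrite [in X in X ^+ _ * torus_factor _]addrC; ring.
have DE : (1 + 'X^1) * \sum_(i < l * m) (- 'X) ^+ i = 1 + 'X^(l * m) :> {poly 'F_l}.
  by rewrite alternating_geometric // oddM l_odd.
rewrite torus_factorE -[RHS]mulrA -[in RHS]exprMn DE -frob mulrA -exprD -exprSr.
by have -> : (h.+1 + h.+1).+1 = l by rewrite lE addnn.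
Qed.
End TorusFactor.

(** * Evaluation and congruence of integer Laurent polynomials *)

Lemma leval_lpoly (K : fieldType) (u : K) (p : {poly int}) :
  leval u (lpoly p) = (map_poly intr p).[u].
Proof. by rewrite /leval /= expr0z mul1r. Qed.

Lemma leval_torus_alexander (K : fieldType) (u : K) q :
  leval u (lpoly (torus_alexander q)) = \sum_(i < q) (- u) ^+ i.
Proof.
rewrite leval_lpoly -[_.[u]]/((horner_eval u \o map_poly intr) _).
by rewrite rmorph_alternating /= map_polyX /horner_eval hornerX.
Qed.

Lemma leval_torus_factor (K : fieldType) (u : K) l m h :
  leval u (lpoly (torus_factor l m h 'X)) = torus_factor l m h u.
Proof.
rewrite leval_lpoly -[_.[u]]/((horner_eval u \o map_poly intr) _).
by rewrite rmorph_torus_factor /= map_polyX /horner_eval hornerX.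
Qed.

Lemma lcongr_Fp l d d' (p p' : {poly int}) :
    prime l -> d = d' -> map_poly intr p = map_poly intr p' :> {poly 'F_l} ->
  lcongr l (Laurent d p) (Laurent d' p').
Proof.
move=> l_prime <- pp' k; rewrite /lcoef /=; case: (k - d) => // i.
apply/eqP; rewrite eqz_mod_dvd (dvdz_pcharf (pchar_Fp l_prime)) rmorphB subr_eq0.
by rewrite -!coef_map pp'.
Qed.

Theorem corollary13 (R : realType) (q l : nat)
    (q_odd : odd q) (q_ge3 : (3 <= q)%N)
    (l_prime : prime l) (l_odd : odd l) (l_dvd_q : (l %| q)%N)
    (pi : dihedral_group l -> 'M[R[i]]_l)
    (pi_rep : is_matrix_rep pi)
    (pi_x : pi (dihedral_x l) = flip_mx _ l)
    (pi_y : pi (dihedral_y l) = shift_mx _ l)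
    (rho : {multiplicative knot_group q -> dihedral_group l})
    (rho_surj : forall d : dihedral_group l, exists g : knot_group q, rho g = d) :
  let t : {fraction {poly R[i]}} := ratvar _ in
  exists (Dtw : {fraction {poly R[i]}}) (D f : laurent),
    [/\ is_twisted_alexander (pi \o rho) Dtw,
        is_alexander q D,
        Dtw = leval t D / (t - 1) * leval t f * leval (- t) f
      & lcongr l (lmul (lexp (lpoly ('X + 1)) (l.-1./2)) f)
                 (lexp D (l.-1./2))].
Proof.
case: l l_prime l_odd l_dvd_q pi pi_rep pi_x pi_y rho rho_surj => [|[|n]] //.
move=> l_prime l_odd l_dvd_q pi pi_rep pi_x pi_y rho rho_surj t.
have [alpha [beta [Uba phia phib]]] :=
  knot_dihedral_images l_prime l_odd pi_rep pi_x pi_y rho_surj.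
have phi_rep : is_matrix_rep (pi \o rho) by exact: rep_comp.
(* An odd prime is at least 3, so (l - 1)/2 is positive and has the form [h.+1]. *)
have [h lE] : exists h, n.+2 = h.+1.*2.+1 by exists n.-1./2; lia.
have hE : n.+2.-1./2 = h.+1 by lia.
have [m qE] : exists m, q = (n.+2 * m)%N.
  by exists (q %/ n.+2)%N; rewrite mulnC divnK.
have m_odd : odd m by move: q_odd; rewrite qE oddM => /andP[].
have U2 : (2 : 'Z_n.+2) \is a GRing.unit.
  by rewrite unitZpE // coprimen2.
have bq0 : (beta - alpha) *+ q = 0.
  by rewrite qE mulrnA -(mulr_natr _ n.+2) pchar_Zp // mulr0 mul0rn.
(* For these representatives the identity holds exactly, so both unit factors are 1. *)
exists (twisted_alexander (pi \o rho)), (lpoly (torus_alexander q)),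
  (lpoly (torus_factor n.+2 m h 'X)); split.
- by exists false, 0; rewrite mul0r expr0z !mul1r.
- by exists false, 0; rewrite mul1r.
- rewrite (twisted_alexander_dihedral q_odd lE U2 Uba bq0 phia phib).
  rewrite leval_torus_alexander !leval_torus_factor qE.
  by apply: twisted_factorization => //; exact: ratvar_unity.
rewrite hE; apply: lcongr_Fp => //=; first by rewrite mul0rn addr0.
rewrite rmorphM !rmorphXn rmorph_torus_factor rmorph_alternating rmorphD rmorph1 /=.
by rewrite map_polyX qE; exact: torus_factor_congr.
Qed.
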